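(* Let $f:\mathbb{R}^n\to\mathbb{R}$ and $g:\mathbb{R}^m\to\mathbb{R}$ be continuously differentiable and convex, let $A\in\mathbb{R}^{m\times n}$ with $m\ge n$ have full column rank, and let $V(x)=f(x)+g(Ax)$. Let $t_0\ge0$ and let $X:[t_0,\infty)\to\mathbb{R}^n$ be a trajectory of the ADMM flow $$\dot X+(A^TA)^{-1}\nabla V(X)=0$$ with initial condition $X(t_0)=x_0$. Assume that $\operatorname{argmin}V\neq\emptyset$ and let $V^\star=\min_xV(x)$. Then there is a constant $C>0$ such that $$V(X(t))-V^\star\le\frac{C}{t}$$ for all $t\ge t_0$ with $t>0$.
   Context: A trajectory is a differentiable curve satisfying the differential equation for all $t\ge t_0$. The constant $C$ may depend on the trajectory (in particular on $x_0$ and $t_0$) but not on $t$. *)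

(* Defs.v *)
From HB Require Import structures.
From mathcomp Require Export all_boot all_order all_algebra.
From mathcomp Require Export all_classical all_reals all_analysis.
Export Order.TTheory GRing.Theory Num.Theory.
Export numFieldNormedType.Exports.

#[export] Set Implicit Arguments.
#[export] Unset Strict Implicit.
#[export] Unset Printing Implicit Defensive.

Local Open Scope classical_set_scope.
Local Open Scope ring_scope.

(* R^n is the space of column vectors 'cV[R]_n with R : realType; its topology is
   that of the sup norm, which induces the same notions of differentiability and
   continuity as the Euclidean one. *)

Definition grad (R : realType) (n : nat) (f : 'cV[R]_n -> R) (x : 'cV[R]_n) :
    'cV[R]_n :=
  \col_(i < n) 'D_(delta_mx i 0) f x.

Definition C1 (R : realType) (n : nat) (f : 'cV[R]_n -> R) : Prop :=
  (forall x, differentiable f x) /\ continuous (grad f).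

Definition convex_on_space (R : realType) (n : nat) (f : 'cV[R]_n -> R) : Prop :=
  convex_function [set: convex_lmodType 'cV[R]_n] f.

Definition objective (R : realType) (m n : nat) (f : 'cV[R]_n -> R)
    (g : 'cV[R]_m -> R) (A : 'M[R]_(m, n)) (x : 'cV[R]_n) : R :=
  f x + g (A *m x).

Definition argmin (R : realType) (T : Type) (V : T -> R) : set T :=
  [set x | forall y, V x <= V y].

Definition is_min (R : realType) (T : Type) (V : T -> R) (v : R) : Prop :=
  exists2 x, argmin V x & V x = v.

(* Derivative relative to a subset D of the line: s tends to t inside D. At the
   end point of a closed half-line this is the one-sided derivative, and the
   values of X outside D are irrelevant when t belongs to D. *)
Definition is_derive_within (R : realType) (n : nat) (D : set R)
    (X : R -> 'cV[R]_n) (t : R) (dX : 'cV[R]_n) : Prop :=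
  (s - t)^-1 *: (X s - X t) @[s --> within D t^'] --> dX.

(* X : R -> 'cV[R]_n stands for a curve on [t0, +oo[. *)
Definition admm_trajectory (R : realType) (m n : nat) (f : 'cV[R]_n -> R)
    (g : 'cV[R]_m -> R) (A : 'M[R]_(m, n)) (t0 : R) (X : R -> 'cV[R]_n) : Prop :=
  forall t, t0 <= t -> exists2 dX : 'cV[R]_n,
    is_derive_within `[t0, +oo[ X t dX &
    dX + invmx (A^T *m A) *m grad (objective f g A) (X t) = 0.

(* Main.v *)
(* The Lyapunov function E(t) = t (V(X(t)) - Vstar) + |A (X(t) - z)|^2 / 2, with
   z a minimizer, is nonincreasing along the flow: as A^T A X' = - grad V(X),
     E' = V(X) - Vstar - t |A X'|^2 - <grad V(X), X - z>,
   and convexity gives <grad V(X), X - z> >= V(X) - Vstar. Hence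
   t (V(X(t)) - Vstar) <= E(t) <= E(t0). *)
From mathcomp Require Import ring lra.
Require Import Defs.

Local Open Scope classical_set_scope.
Local Open Scope ring_scope.

(** * Euclidean inner product and invertibility of the Gram matrix *)

Section Dot.
Context {R : realType}.

(** The norm carried by ['cV[R]_n] is the sup norm, so the Euclidean product is built by hand as the
    entry of a 1 x 1 matrix. *)
Definition dot (n : nat) (u v : 'cV[R]_n) : R := (u^T *m v) 0 0.

Lemma dotE n (u v : 'cV[R]_n) : dot u v = \sum_i u i 0 * v i 0.
Proof. by rewrite /dot mxE; apply: eq_bigr => i _; rewrite mxE. Qed.

Lemma dot_ge0 n (u : 'cV[R]_n) : 0 <= dot u u.
Proof. by rewrite dotE sumr_ge0// => i _; rewrite -expr2 sqr_ge0. Qed.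

Lemma dot_eq0 n (u : 'cV[R]_n) : dot u u = 0 -> u = 0.
Proof.
rewrite dotE => /eqP; rewrite psumr_eq0; last first.
  by move=> i _; rewrite -expr2 sqr_ge0.
move=> /allP u0; apply/colP => i; rewrite mxE; apply/eqP.
by have := u0 i (mem_index_enum i); rewrite mulf_eq0 orbb.
Qed.

Lemma dot_mulmx m n (A : 'M[R]_(m, n)) (u v : 'cV[R]_n) :
  dot (A *m u) (A *m v) = dot u (A^T *m A *m v).
Proof. by rewrite /dot trmx_mul !mulmxA. Qed.

Lemma dotC n (u v : 'cV[R]_n) : dot u v = dot v u.
Proof. by rewrite !dotE; apply: eq_bigr => i _; rewrite mulrC. Qed.

Lemma dotNr n (u v : 'cV[R]_n) : dot u (- v) = - dot u v.
Proof. by rewrite /dot mulmxN mxE. Qed.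

(** If [v *m (A^T *m A) = 0], pairing with [v] gives |A v^T|^2 = 0, so [v *m A^T = 0]; a right
    inverse of [A^T], which full column rank supplies, then forces [v = 0]. *)
Lemma gram_unitmx m n (A : 'M[R]_(m, n)) : \rank A = n -> A^T *m A \in unitmx.
Proof.
move=> rA; rewrite -row_free_unit; apply: inj_row_free => v vA0.
have Av0 : A *m v^T = 0.
  by apply: dot_eq0; rewrite dot_mulmx /dot trmxK mulmxA vA0 mul0mx mxE.
have /row_freeP[B AB] : row_free A^T by rewrite /row_free mxrank_tr rA.
have vA : v *m A^T = 0 by rewrite -[v]trmxK -trmx_mul Av0 trmx0.
by rewrite -[v]mulmx1 -AB mulmxA vA mul0mx.
Qed.

End Dot.

(** * Gradients, first-order convexity, derivatives within a half-line *)

Section Calculus.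
Context {R : realType}.

Lemma differentiable_mulmx m n (A : 'M[R]_(m, n)) (x : 'cV[R]_n) :
  differentiable (mulmx A : 'cV[R]_n -> 'cV[R]_m) x.
Proof.
(* A x is the combination of the columns of [A] weighted by the coordinates of x, and coordinates
   are differentiable. *)
have -> : (mulmx A : 'cV[R]_n -> 'cV[R]_m) =
    \sum_(j < n) (fun y : 'cV[R]_n => y j 0 *: col j A).
  apply/funext => y; rewrite fct_sumE; apply/colP => i; rewrite summxE mxE.
  by apply: eq_bigr => j _; rewrite !mxE mulrC.
apply: differentiable_sum => j.
by apply: differentiableZl; exact: differentiable_coord.
Qed.

Lemma derive_mulmx m n (A : 'M[R]_(m, n)) (x v : 'cV[R]_n) :
  'D_v (mulmx A : 'cV[R]_n -> 'cV[R]_m) x = A *m v.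
Proof.
rewrite deriveE; last exact: differentiable_mulmx.
rewrite diff_lin// => y; exact/differentiable_continuous/differentiable_mulmx.
Qed.

Lemma deriveE_grad n (F : 'cV[R]_n -> R) (x v : 'cV[R]_n) :
  differentiable F x -> 'D_v F x = dot (grad F x) v.
Proof.
move=> dF; rewrite deriveE// dotE {1}(matrix_sum_delta v) linear_sum/=.
apply: eq_bigr => i _; rewrite big_ord1 linearZ/= mxE deriveE//.
by rewrite mulrC.
Qed.

Lemma is_derive_comp_curve (V W : normedModType R) (X : R -> V) (dX : V)
    (F : V -> W) (t : R) :
  is_derive t 1 X dX -> differentiable F (X t) ->
  is_derive t 1 (F \o X) ('D_dX F (X t)).
Proof.
move=> [/derivable1_diffP Xt <-] dF.
have FXt : differentiable (F \o X) t by exact: differentiable_comp.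
apply: DeriveDef; first exact/derivable1_diffP.
by rewrite !deriveE// diff_comp.
Qed.

Lemma is_derive_coord m n (Y : R -> 'M[R]_(m, n)) (dY : 'M[R]_(m, n)) (t : R)
    i j :
  is_derive t 1 Y dY -> is_derive t 1 (fun s => Y s i j) (dY i j).
Proof.
move=> [Yt <-]; apply: DeriveDef; first by move/derivable_mxP: Yt; exact.
by rewrite derive_mx// mxE.
Qed.

Lemma continuous_dot n : continuous (fun u : 'cV[R]_n => dot u u).
Proof.
move=> u; apply: differentiable_continuous.
have -> : (fun v : 'cV[R]_n => dot v v) =
    \sum_(i < n) ((fun v : 'cV[R]_n => v i 0) * (fun v : 'cV[R]_n => v i 0)).
  by apply/funext => v; rewrite dotE fct_sumE.
apply: differentiable_sum => i.
by apply: differentiableM; exact: differentiable_coord.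
Qed.

Lemma is_derive_dot n (Y : R -> 'cV[R]_n) (dY : 'cV[R]_n) (t : R) :
  is_derive t 1 Y dY ->
  is_derive t 1 (fun s => dot (Y s) (Y s)) (2 * dot (Y t) dY).
Proof.
move=> Yt.
have -> : (fun s => dot (Y s) (Y s)) =
    \sum_(i < n) ((fun s => Y s i 0) * (fun s => Y s i 0)).
  by apply/funext => s; rewrite dotE fct_sumE.
have dYi i := is_derive_coord i 0 Yt.
apply: is_derive_eq.
rewrite dotE mulr_sumr; apply: eq_bigr => i _.
by rewrite -mulr2n mulr_natl.
Qed.

(** Convexity bounds the difference quotient at every step h in (0, 1] by [F y - F x]; the bound
    survives the limit h -> 0+. *)
Lemma convex_derive_le n (F : 'cV[R]_n -> R) (x y : 'cV[R]_n) :
  convex_on_space F -> differentiable F x -> 'D_(y - x) F x <= F y - F x.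
Proof.
move=> Fconv /diff_derivable-/(_ (y - x)) Fx.
apply: (cvgr_to_le (cvg_dnbhs_at_right Fx)).
near=> h.
have h0 : 0 < h by near: h; exact: nbhs_right_gt.
have h1 : h <= 1 by near: h; exact: nbhs_right_le.
have Fh : F (h *: y + (1 - h) *: x) <= h * F y + (1 - h) * F x.
  by apply: (Fconv (Itv01 (ltW h0) h1)); rewrite inE.
rewrite /= -[_ *: _]/(_ * _) ler_pdivrMl//.
have -> : h *: (y - x) + x = h *: y + (1 - h) *: x.
  by rewrite scalerBr scalerBl scale1r -addrA [- _ + _]addrC.
lra.
Unshelve. all: by end_near. Qed.

Lemma is_derive_within_interior n (X : R -> 'cV[R]_n) (t0 t : R)
    (dX : 'cV[R]_n) :
  t0 < t -> is_derive_within `[t0, +oo[ X t dX -> is_derive t 1 X dX.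
Proof.
move=> t0t XdX.
suff H : h^-1 *: ((X \o shift t) (h *: 1) - X t) @[h --> 0^'] --> dX.
  by apply: DeriveDef; [apply/cvg_ex; exists dX | exact: cvg_lim].
apply/cvgrPdist_lt => e e0.
have /cvgrPdist_lt/(_ _ e0) := XdX.
rewrite !near_withinE => /nbhs_ballP[r /= r0 Hr].
(* The bound [t - t0] on the radius keeps [h + t] inside the half-line, where the relative limit
   speaks. *)
have d0 : 0 < Num.min r (t - t0) by rewrite lt_min r0 subr_gt0.
apply/nbhs_ballP; exists (Num.min r (t - t0)) => //= h.
rewrite /ball/= sub0r normrN lt_min => /andP[hr ht] h0.
have := Hr (h + t).
rewrite /ball/= opprD addrCA subrr addr0 normrN => /(_ hr).
rewrite -subr_eq0 addrK in_itv/= andbT [h%:A]mulr1; apply => //.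
by move: ht; rewrite ltr_norml => /andP[+ _]; rewrite opprB ltrBlDr => /ltW.
Qed.

(** Multiplying the difference quotient by [s - t], which tends to 0, gives continuity relative to
    [D]. This also covers the end point [t0], where no two-sided derivative is available. *)
Lemma is_derive_within_cvg n (D : set R) (X : R -> 'cV[R]_n) (t : R)
    (dX : 'cV[R]_n) :
  is_derive_within D X t dX -> X s @[s --> within D (nbhs t)] --> X t.
Proof.
move=> XdX.
have : (s - t) *: ((s - t)^-1 *: (X s - X t)) @[s --> within D t^'] --> 0 *: dX.
  apply: cvgZ => //; rewrite -(subrr t); apply: cvgB; last exact: cvg_cst.
  by apply: cvg_within_filter; apply: cvg_within_filter; exact: cvg_id.
rewrite scale0r => H; apply/cvgrPdist_lt => e e0.
move/cvgrPdist_lt : H => /(_ _ e0); rewrite !near_withinE.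
apply: filterS => s Hs Ds.
(* The punctured limit says nothing at [s = t], but there the increment is 0. *)
have [->|st] := eqVneq s t; first by rewrite subrr normr0.
have := Hs st Ds; rewrite sub0r normrN scalerA divff ?subr_eq0// scale1r.
by rewrite distrC.
Qed.

End Calculus.

(** * Differentiability and convexity of the objective *)

Section Objective.
Context {R : realType} {m n : nat}.
Variables (f : 'cV[R]_n -> R) (g : 'cV[R]_m -> R) (A : 'M[R]_(m, n)).

Lemma differentiable_objective x :
  differentiable f x -> differentiable g (A *m x) ->
  differentiable (objective f g A) x.
Proof.
move=> df dg.
have -> : objective f g A = f + (g \o mulmx A) by [].
apply: differentiableD => //; apply: differentiable_comp => //.
exact: differentiable_mulmx.
Qed.

Lemma convex_objective : convex_on_space f -> convex_on_space g ->
  convex_on_space (objective f g A).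
Proof.
move=> fconv gconv p x y _ _.
have /= := lerD (fconv p x y _ _) (gconv p (A *m x) (A *m y) _ _).
rewrite !inE => /(_ I I I I) fg.
suff -> : objective f g A (conv p x y) =
    f (conv p x y) + g (conv p (A *m x : convex_lmodType 'cV[R]_m) (A *m y)).
  by rewrite (le_trans fg)// [leRHS]convRE /objective !convRE; lra.
by rewrite /objective /conv/= mulmxDr -!scalemxAr.
Qed.

End Objective.

Theorem theorem7 (R : realType) (m n : nat)
    (f : 'cV[R]_n -> R) (g : 'cV[R]_m -> R) (A : 'M[R]_(m, n))
    (hfC1 : C1 f) (hgC1 : C1 g)
    (hfconv : convex_on_space f) (hgconv : convex_on_space g)
    (hmn : (n <= m)%N) (hA : \rank A = n)
    (t0 : R) (ht0 : 0 <= t0) (x0 : 'cV[R]_n) (X : R -> 'cV[R]_n)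
    (hX : admm_trajectory f g A t0 X) (hX0 : X t0 = x0)
    (hargmin : argmin (objective f g A) !=set0)
    (Vstar : R) (hVstar : is_min (objective f g A) Vstar) :
  exists2 C : R, 0 < C &
    forall t : R, t0 <= t -> 0 < t ->
      objective f g A (X t) - Vstar <= C / t.
Proof.
have dV x : differentiable (objective f g A) x.
  by apply: differentiable_objective; [exact: hfC1.1 | exact: hgC1.1].
have Vconv := convex_objective A hfconv hgconv.
move: hX hVstar; rewrite /admm_trajectory.
set V := objective f g A in dV Vconv *.
move=> {}hX [z zmin Vz].
pose Y t := A *m (X t - z).
pose E t := t * (V (X t) - Vstar) + 2^-1 * dot (Y t) (Y t).
have Vge x : 0 <= V x - Vstar by rewrite subr_ge0 -Vz.
have dY t : differentiable (fun x => A *m (x - z)) t.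
  apply: (@differentiable_comp _ _ _ _ (fun x => x - z) (mulmx A)).
    by apply: differentiableB.
  exact: differentiable_mulmx.
have XC t : t0 <= t -> X s @[s --> within `[t0, +oo[ (nbhs t)] --> X t.
  by move=> /hX[dX /is_derive_within_cvg].
(* Only the open half-line is treated here, since the derivative of [X] at [t0] is one-sided. *)
have dE t : t0 < t -> exists2 d, is_derive t 1 E d & d <= 0.
  move=> t0t; have [dX Xt flow] := hX _ (ltW t0t).
  have {}Xt := is_derive_within_interior t0t Xt.
  have VXt := is_derive_comp_curve Xt (dV (X t)).
  have Yt : is_derive t 1 Y (A *m dX).
    have Xzt : is_derive t 1 (fun s => X s - z) dX.
      by apply: is_derive_eq; rewrite subr0.
    have := is_derive_comp_curve Xzt (differentiable_mulmx A (X t - z)).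
    by rewrite derive_mulmx.
  have YYt := is_derive_dot Yt.
  have gramdX : A^T *m A *m dX = - grad V (X t).
    apply/eqP; rewrite -addr_eq0 -[grad V _](mulKVmx (gram_unitmx hA)) -mulmxDr.
    by rewrite flow mulmx0.
  have Et : is_derive t 1 E ((V (X t) - Vstar) + t * dot (grad V (X t)) dX
      + dot (Y t) (A *m dX)).
    (* [E] is recast with operations on functions so that its derivative can be inferred from those
       of its pieces. *)
    have -> : E = id * (V \o X - cst Vstar) +
        2^-1 *: (fun s => dot (Y s) (Y s)).
      by apply/funext.
    apply: is_derive_eq; rewrite (deriveE_grad _ (dV _)) subr0.
    rewrite -[LHS]/(t * dot (grad V (X t)) dX + (V (X t) - Vstar) * 1
      + 2^-1 * (2 * dot (Y t) (A *m dX))).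
    by field.
  eexists; first exact: Et.
  (* By the flow equation the left side is -|A X'|^2. *)
  have gV : dot (grad V (X t)) dX <= 0.
    rewrite dotC -[grad V _]opprK -gramdX dotNr -dot_mulmx oppr_le0.
    exact: dot_ge0.
  (* Moving [A] across the product turns the left side into <grad V(X), z - X>, the derivative of
     [V] at X towards the minimizer. *)
  have gY : dot (Y t) (A *m dX) <= Vstar - V (X t).
    rewrite dot_mulmx gramdX dotNr dotC -dotNr opprB -deriveE_grad// -Vz.
    exact: convex_derive_le.
  have : t * dot (grad V (X t)) dX <= 0.
    by rewrite mulr_ge0_le0// (le_trans ht0)// ltW.
  lra.
(* Continuity relative to the closed interval is what carries the monotonicity of [E] down to
   [t0]. *)
have EC T : {within `[t0, T], continuous E}.
  apply/subspace_continuousP => t /=; rewrite in_itv/= => /andP[t0t tT].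
  have {}XC : X s @[s --> within `[t0, T] (nbhs t)] --> X t.
    apply: cvg_trans (XC _ t0t); apply: cvg_app; apply: within_subset => s /=.
    by rewrite !in_itv/= andbT => /andP[].
  have VXC :
      V (X s) - Vstar @[s --> within `[t0, T] (nbhs t)] --> V (X t) - Vstar.
    apply: cvgB; last exact: cvg_cst.
    exact: (continuous_cvg _ (differentiable_continuous (dV _)) XC).
  have YC : Y s @[s --> within `[t0, T] (nbhs t)] --> Y t.
    exact: (continuous_cvg _ (differentiable_continuous (dY _)) XC).
  apply: cvgD.
    by apply: cvgM => //; apply: cvg_within_filter; exact: cvg_id.
  apply: cvgM; first exact: cvg_cst.
  exact: (continuous_cvg _ (@continuous_dot _ _ (Y t)) YC).
have Ele t : t0 <= t -> E t <= E t0.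
  move=> t0t; apply: (ler0_derive1_le_cc _ _ (EC t)) => //.
  - by move=> s; rewrite in_itv/= => /andP[/dE[d [Es _] _] _].
  - move=> s; rewrite in_itv/= => /andP[/dE[d [_ Es] d0] _].
    by rewrite derive1E Es.
  - by rewrite in_itv/= lexx t0t.
  - by rewrite in_itv/= lexx t0t.
have E0 : 0 <= E t0 by rewrite addr_ge0// mulr_ge0// dot_ge0.
(* [E t0] can vanish, for instance when the curve starts at [z]; adding 1 makes the constant
   positive. *)
exists (E t0 + 1) => [|t t0t t_gt0]; first by rewrite ltr_wpDl.
rewrite ler_pdivlMr// mulrC.
have VE : t * (V (X t) - Vstar) <= E t by rewrite lerDl mulr_ge0// dot_ge0.
by have := Ele t t0t; lra.
Qed.
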